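(* Let $p$ be a semi-regular odd prime, let $i$ be an odd integer with $3\le i\le p-2$, and suppose $\lambda_i=1$. If the $p$-adic $L$-function $L_p(s,\omega^{1-i})$ has no zeroes of the form $$s_0=\log_{1+p}(1+ap^2)=bp,\qquad a,b\in\mathbb{Z}_p,$$ then $L_p(0,\omega^{1-i})$ is not divisible by $p^2$.
   Context: An odd prime $p$ is called semi-regular if $p$ does not divide the class number of $\mathbb{Q}(\zeta_0+\zeta_0^{-1})$ (Vandiver's conjecture), where $\zeta_0$ is a primitive $p$-th root of unity. $\omega$ is the Teichmüller character of $(\mathbb{Z}/p)^\times$ and $L_p$ the $p$-adic $L$-function. Let $f_i(T)\in\mathbb{Z}_p[[T]]$ be the power series with $f_i((1+p)^s-1)=L_p(s,\omega^{1-i})$; the Iwasawa number $\lambda_i$ is the index of the first coefficient of $f_i$ not divisible by $p$. For $u\in 1+p\mathbb{Z}_p$, $\log_{1+p}(u)$ denotes the unique $s\in\mathbb{Z}_p$ with $(1+p)^s=u$. Divisibility is in $\mathbb{Z}_p$. *)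

(* Defs.v *)
From HB Require Import structures.
From mathcomp Require Import all_boot all_order all_algebra all_field.
From mathcomp Require Import finmap.
From mathcomp Require Import boolp classical_sets functions cardinality.

Set Implicit Arguments.
Unset Strict Implicit.
Unset Printing Implicit Defensive.

Import Order.TTheory GRing.Theory Num.Theory.

Local Open Scope classical_set_scope.
Local Open Scope ring_scope.

(* Z_p is the inverse limit of the Z/p^n.  An element is given by its residues
   modulo p^n, each represented in [0, p^n); the single equation below says
   both that they are so reduced and that they are compatible.  The proof of
   primality is a parameter of the type because the integral domain structure
   requires it. *)
Record padic_int (p : nat) (p_pr : prime p) := PadicInt {
  residue :> nat -> int;
  _ : `[< forall n, residue n = (residue n.+1 %% (p ^ n)%N%:Z)%Z >]
}.

Section PadicRing.
Variables (p : nat) (p_pr : prime p).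
Local Notation Zp := (padic_int p_pr).
Local Notation q n := ((p ^ n)%N%:Z).

HB.instance Definition _ := [isSub for @residue p p_pr].
HB.instance Definition _ := [Choice of padic_int p_pr by <:].

Lemma modz_dvdm (m d e : int) : (d %| e)%Z -> ((m %% e)%Z = m %[mod d])%Z.
Proof.
case/dvdzP=> c ->; rewrite [in RHS](divz_eq m (c * d)) mulrA.
by rewrite modzMDl.
Qed.

Lemma residueE (x : Zp) n : x n = (x n.+1 %% q n)%Z.
Proof. by case: x => x /= /asboolP. Qed.

Lemma residue_mod (x : Zp) n : (x n %% q n)%Z = x n.
Proof. by rewrite residueE modz_mod. Qed.

Lemma padic_eqP (x y : Zp) : (forall n, x n = y n) -> x = y.
Proof. by move=> xy; apply/val_inj/funext. Qed.

Lemma padic_lim_subproof (u : nat -> int) :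
  (forall n, (u n.+1 = u n %[mod q n])%Z) ->
  `[< forall n, (u n %% q n)%Z = ((u n.+1 %% q n.+1)%Z %% q n)%Z >].
Proof.
move=> hu; apply/asboolP => n; rewrite -(hu n) expnS PoszM.
by rewrite modz_dvdm // dvdz_mull.
Qed.

Definition padic_lim u hu : Zp := PadicInt p_pr (@padic_lim_subproof u hu).

Lemma padic_limE u hu n : padic_lim (u := u) hu n = (u n %% q n)%Z.
Proof. by []. Qed.

Lemma padic_int_subproof (z : int) n : (z = z %[mod q n])%Z.
Proof. by []. Qed.
Lemma padic_opp_subproof (x : Zp) n : (- x n.+1 = - x n %[mod q n])%Z.
Proof. by rewrite (residueE x n) modzNm. Qed.
Lemma padic_add_subproof (x y : Zp) n :
  (x n.+1 + y n.+1 = x n + y n %[mod q n])%Z.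
Proof. by rewrite (residueE x n) (residueE y n) modzDm. Qed.
Lemma padic_mul_subproof (x y : Zp) n :
  (x n.+1 * y n.+1 = x n * y n %[mod q n])%Z.
Proof. by rewrite (residueE x n) (residueE y n) modzMm. Qed.

Definition padic_of_int z := padic_lim (padic_int_subproof z).
Definition padic_opp x := padic_lim (padic_opp_subproof x).
Definition padic_add x y := padic_lim (padic_add_subproof x y).
Definition padic_mul x y := padic_lim (padic_mul_subproof x y).

Fact padic_addA : associative padic_add.
Proof. by move=> x y z; apply: padic_eqP => n /=; rewrite modzDml modzDmr addrA. Qed.
Fact padic_addC : commutative padic_add.
Proof. by move=> x y; apply: padic_eqP => n /=; rewrite addrC. Qed.
Fact padic_add0 : left_id (padic_of_int 0) padic_add.
Proof. by move=> x; apply: padic_eqP => n /=; rewrite mod0z add0r residue_mod. Qed.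
Fact padic_addN : left_inverse (padic_of_int 0) padic_opp padic_add.
Proof. by move=> x; apply: padic_eqP => n /=; rewrite modzDml addNr. Qed.

HB.instance Definition _ := GRing.isZmodule.Build Zp
  padic_addA padic_addC padic_add0 padic_addN.

Fact padic_mulA : associative padic_mul.
Proof. by move=> x y z; apply: padic_eqP => n /=; rewrite modzMml modzMmr mulrA. Qed.
Fact padic_mulC : commutative padic_mul.
Proof. by move=> x y; apply: padic_eqP => n /=; rewrite mulrC. Qed.
Fact padic_mul1 : left_id (padic_of_int 1) padic_mul.
Proof. by move=> x; apply: padic_eqP => n /=; rewrite modzMml mul1r residue_mod. Qed.
Fact padic_mulD : left_distributive padic_mul padic_add.
Proof.
by move=> x y z; apply: padic_eqP => n /=; rewrite modzMml modzDm mulrDl.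
Qed.
Fact padic_1neq0 : padic_of_int 1 != 0.
Proof.
apply/eqP => /(congr1 (fun x : Zp => x 1%N)) /=.
by rewrite expn1 mod0z modz_small // ltz_nat prime_gt1.
Qed.

HB.instance Definition _ := GRing.Zmodule_isComNzRing.Build Zp
  padic_mulA padic_mulC padic_mul1 padic_mulD padic_1neq0.

Definition padic_unit : pred Zp := fun x => `[< exists y, y * x = 1 >].
Definition padic_inv (x : Zp) : Zp :=
  if padic_unit x then xget 0 [set y | y * x = 1] else x.

Fact padic_mulV : {in padic_unit, left_inverse 1 padic_inv *%R}.
Proof.
move=> x xU; have xU' : padic_unit x by []; rewrite /padic_inv xU'.
by case: xgetP => [y _ //|] none; case/asboolP: xU' => y /none.
Qed.
Fact padic_unitP (x y : Zp) : y * x = 1 -> padic_unit x.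
Proof. by move=> yx; apply/asboolP; exists y. Qed.
Fact padic_inv_out : {in [predC padic_unit], padic_inv =1 id}.
Proof. by move=> x /negbTE; rewrite /padic_inv => xU; rewrite [padic_unit x]xU. Qed.

HB.instance Definition _ := GRing.ComNzRing_hasMulInverse.Build Zp
  padic_mulV padic_unitP padic_inv_out.

Lemma residue_leq (x : Zp) n k : (x (k + n)%N = x n %[mod q n])%Z.
Proof.
elim: k => [//|k IH]; rewrite -IH addSn (residueE x (k + n)).
by rewrite expnD PoszM modz_dvdm // dvdz_mull.
Qed.

Fact padic_idomain (x y : Zp) : x * y = 0 -> (x == 0) || (y == 0).
Proof.
move=> xy0; apply/norP => -[x0 y0].
have nz (z : Zp) : z != 0 -> exists n, forall k, ~~ (p ^ n %| `|z (k + n)%N|)%N.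
  move=> z0; apply: contrapT => h; case/eqP: z0; apply: padic_eqP => n /=.
  rewrite mod0z -(residue_mod z); apply/eqP; apply: contrapT => zn; apply: h.
  exists n => k; apply/negP => dz; apply: zn.
  by rewrite -(residue_leq z n k); apply/eqP/dvdz_mod0P.
have [n xn] := nz _ x0; have [m ym] := nz _ y0.
have := congr1 (fun z : Zp => z (n + m)%N) xy0 => /=.
rewrite mod0z => /dvdz_mod0P; rewrite dvdzE abszM /=.
move: (xn m) (ym n); rewrite [(m + n)%N]addnC.
set a := `|_|%N; set b := `|_|%N => na nb.
have a0 : (0 < a)%N by case: (a) na => //; rewrite dvdn0.
have b0 : (0 < b)%N by case: (b) nb => //; rewrite dvdn0.
rewrite pfactor_dvdn ?muln_gt0 ?a0 // lognM //.
by move: na nb; rewrite !pfactor_dvdn // -!ltnNge => l1 l2; rewrite leqNgt -addnS leq_add // ltnW.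
Qed.

HB.instance Definition _ := GRing.ComUnitRing_isIntegral.Build Zp padic_idomain.

End PadicRing.

Notation "x %:F" := (tofrac x) : ring_scope.

Section PadicAnalysis.
Variables (p : nat) (p_pr : prime p).
Local Notation Zp := (padic_int p_pr).
Local Notation Qp := {fraction padic_int p_pr}.

Definition pdiv_pow (k : nat) (x : Qp) :=
  exists z : Zp, x = (p%:R ^+ k * z)%:F.

Definition padic_cvg (u : nat -> Zp) (l : Zp) :=
  forall k, exists N, forall n, (N <= n)%N -> pdiv_pow k (u n - l)%:F.

Definition padic_continuous (g : Zp -> Qp) :=
  forall s k, exists m, forall t,
    pdiv_pow m (t - s)%:F -> pdiv_pow k (g t - g s).

(* u^s for u in 1 + p Z_p and s in Z_p: the limit of u^n as the natural number
   n tends p-adically to s *)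
Definition padic_pow (u s : Zp) : Zp :=
  xget 0 [set v | forall k, exists m, forall n : nat,
    pdiv_pow m (s - n%:R)%:F -> pdiv_pow k (v - u ^+ n)%:F].

(* For u in 1 + p Z_p, p odd, the s below exists and is unique; 0 is a default
   value for other u. *)
Definition padic_log1p (u : Zp) : Zp :=
  xget 0 [set s | padic_pow (1 + p%:R) s = u].

(* The sequence f stands for the power series \sum_k f_k T^k in Z_p[[T]];
   the sum at x converges for x in p Z_p. *)
Definition series_eval (f : nat -> Zp) (x : Zp) : Zp :=
  xget 0 [set v | padic_cvg (fun n => \sum_(k < n) f k * x ^+ k) v].

Definition is_iwasawa_lambda (f : nat -> Zp) (l : nat) :=
  ~ pdiv_pow 1 (f l)%:F /\ forall j, (j < l)%N -> pdiv_pow 1 (f j)%:F.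

End PadicAnalysis.

(* B_n is determined by \sum_(k <= n) 'C(n.+1, k) B_k = (n == 0);
   in particular B_1 = -1/2. *)
Fixpoint bernoulli_seq (n : nat) : seq rat :=
  if n is m.+1 then
    let s := bernoulli_seq m in
    rcons s (((m == 0%N)%:R - \sum_(k < m) 'C(m.+1, k)%:R * s`_k) / m.+1%:R)
  else [::].

Definition bernoulli (n : nat) : rat := (bernoulli_seq n.+1)`_n.

Definition bernoulli_poly (n : nat) : {poly rat} :=
  \sum_(k < n.+1) ('C(n, k)%:R * bernoulli k) *: 'X^(n - k).

Section PadicL.
Variables (p : nat) (p_pr : prime p).
Local Notation Zp := (padic_int p_pr).
Local Notation Qp := {fraction padic_int p_pr}.

(* for a prime to p: the (p-1)-st root of unity congruent to a modulo p *)
Definition teichmuller (a : nat) : Zp :=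
  xget 0 [set w | w ^+ p.-1 = 1 /\ pdiv_pow 1 (w - a%:R)%:F].

(* the primitive Dirichlet character attached to omega^m; it has conductor 1
   if p - 1 divides m, and conductor p otherwise *)
Definition omega_pow (m : int) (a : nat) : Zp :=
  if (p %| a)%N then (p.-1%:Z %| m)%Z%:R else teichmuller a ^ m.

Definition omega_conductor (m : int) : nat :=
  if (p.-1%:Z %| m)%Z then 1 else p.

(* B_{n,chi} = F^(n-1) \sum_(1 <= a <= F) chi(a) B_n(a/F), for n >= 1 and
   chi = omega^m of conductor F *)
Definition gen_bernoulli (n : nat) (m : int) : Qp :=
  let F := omega_conductor m in
  F%:R ^+ n.-1 *
  \sum_(1 <= a < F.+1)
     (omega_pow m a)%:F * ratr (bernoulli_poly n).[a%:R / F%:R].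

(* L is the function L_p(-, chi) on Z_p, for chi = omega^k a nontrivial
   character: the continuous function such that, for all n >= 1,
   L(1 - n) = - (1 - chi omega^(-n)(p) p^(n-1)) B_{n, chi omega^(-n)} / n. *)
Definition is_padic_L (k : int) (L : Zp -> Qp) :=
  padic_continuous L /\
  forall n : nat, (0 < n)%N ->
    L (1 - n%:R) =
      - (1 - (omega_pow (k - n%:Z) p)%:F * p%:R ^+ n.-1)
      * gen_bernoulli n (k - n%:Z) / n%:R.

End PadicL.

Section ClassNumber.
Variable K : fieldExtType rat.

Definition ring_of_integers : set K :=
  [set x | integralOver (intr : int -> K) x].

Definition nonzero_ideal : set (set K) :=
  [set I | [/\ I `<=` ring_of_integers,
               I 0,
               forall x y, I x -> I y -> I (x + y),
               forall a x, ring_of_integers a -> I x -> I (a * x) &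
               exists2 x, I x & x != 0]].

Definition ideal_equiv (I J : set K) :=
  exists a b, [/\ ring_of_integers a, ring_of_integers b, a != 0, b != 0 &
    [set a * x | x in I] = [set b * x | x in J]].

Definition ideal_class (I : set K) : set (set K) :=
  [set J | nonzero_ideal J /\ ideal_equiv I J].

(* The set of ideal classes is finite; fset_set would be empty on an infinite
   set. *)
Definition class_number : nat :=
  #|` fset_set [set ideal_class I | I in nonzero_ideal] |%fset.

End ClassNumber.

Definition semi_regular (p : nat) :=
  [/\ prime p, odd p &
      forall (K : fieldExtType rat) (zeta : K), p.-primitive_root zeta ->
        ~~ (p %| class_number (subvs_of <<1; zeta + zeta^-1>>%AS))%N].

(* Main.v *)
Require Import Defs.
From HB Require Import structures.
From mathcomp Require Import all_boot all_order all_algebra all_field.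
From mathcomp Require Import boolp classical_sets.
From mathcomp Require Import ring zify.

Set Implicit Arguments.
Unset Strict Implicit.
Unset Printing Implicit Defensive.

Import GRing.Theory.
Local Open Scope ring_scope.

(** Since [L 0 = f 0], suppose that [p ^ 2] divides the constant term of [f].
    As lambda is 1, [p] divides that term and not the coefficient of [T], so
    Hensel's lemma gives a unique zero [x] of the series in [p Z_p]; it is
    [- f 0 / f 1] to first order, hence divisible by [p ^ 2].  Write
    [x = a p ^ 2].  Because [p] is odd, [s |-> (1 + p) ^ s] maps [Z_p] onto
    [1 + p Z_p], so [s0 = log_(1+p) (1 + a p ^ 2)] satisfies
    [L s0 = f x = 0].  Finally [(1 + p) ^ s0 = 1 + p s0] modulo [p ^ 2], and
    the left side is [1] modulo [p ^ 2], so [p] divides [s0]: this is a zero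
    of the excluded form.

    The zero of [f] and the logarithm come from one fixed-point principle,
    [contraction_root]: a function [G] on [Z_p] with
    [G x - G y = p (x - y)] modulo [p ^ 2 (x - y)], and with [p] dividing
    [G 0], has a zero.  It applies to [t |-> c f(p t)], where [c] inverts the
    linear coefficient modulo [p] ([series_evalB], [series_eval_root]), and to
    [s |-> (1 + p) ^ s - u] ([padic_pow1pB], [padic_log1pK]).  The estimate for
    the exponential extends by density from its case of natural exponents
    [expr1pB], which rests on [(1 + p) ^ (p ^ k) = 1 + p ^ (k + 1)] modulo
    [p ^ (k + 2)]. *)

(** * Divisibility by powers of p, completeness and density *)

Section Divisibility.
Variables (p : nat) (p_pr : prime p).
Local Notation Zp := (padic_int p_pr).
Local Notation P := (p%:R : Zp).
Local Notation q n := ((p ^ n)%N%:Z).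
Implicit Types (x y z : Zp) (k n : nat).

(** The predicate [pdiv_pow] restricted to [Z_p], stated inside the ring so that
    congruences can be handled without passing to fractions. *)
Definition pdvd k x := exists z, x = P ^+ k * z.

Lemma pdvd0 k : pdvd k 0.
Proof. by exists 0; rewrite mulr0. Qed.

Lemma pdvd0n x : pdvd 0 x.
Proof. by exists x; rewrite expr0 mul1r. Qed.

Lemma pdvdD k x y : pdvd k x -> pdvd k y -> pdvd k (x + y).
Proof. by move=> [a ->] [b ->]; exists (a + b); rewrite mulrDr. Qed.

Lemma pdvdN k x : pdvd k x -> pdvd k (- x).
Proof. by move=> [a ->]; exists (- a); rewrite mulrN. Qed.

Lemma pdvdB k x y : pdvd k x -> pdvd k y -> pdvd k (x - y).
Proof. by move=> dx dy; apply: pdvdD => //; apply: pdvdN. Qed.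

Lemma pdvd_subC k x y : pdvd k (x - y) -> pdvd k (y - x).
Proof. by move/pdvdN; rewrite opprB. Qed.

Lemma pdvdM j k x y : pdvd j x -> pdvd k y -> pdvd (j + k) (x * y).
Proof. by move=> [a ->] [b ->]; exists (a * b); rewrite exprD mulrACA. Qed.

Lemma pdvdMl k x y : pdvd k y -> pdvd k (x * y).
Proof. exact: (pdvdM (pdvd0n x)). Qed.

Lemma pdvd_sum k m (F : 'I_m -> Zp) :
  (forall i, pdvd k (F i)) -> pdvd k (\sum_(i < m) F i).
Proof. by move=> dF; apply: big_rec => [|i x _]; [exact: pdvd0|exact: pdvdD]. Qed.

Lemma pdvdW j k x : (j <= k)%N -> pdvd k x -> pdvd j x.
Proof.
move=> le_jk [z ->]; exists (P ^+ (k - j) * z).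
by rewrite mulrA -exprD subnKC.
Qed.

Lemma pdvdX k x : pdvd 1 x -> pdvd k (x ^+ k).
Proof. by case=> z ->; exists (z ^+ k); rewrite expr1 exprMn. Qed.

Lemma pdvd_pM k x : pdvd k x -> pdvd k.+1 (P * x).
Proof. by case=> z ->; exists z; rewrite exprS mulrA. Qed.

Lemma residue_natr m n : (m%:R : Zp) n = (m%:Z %% q n)%Z.
Proof.
elim: m => [//|m IH].
have -> : (m.+1%:R : Zp) n = (((m%:R : Zp) n + (1 : Zp) n) %% q n)%Z.
  by rewrite -addn1 natrD.
have -> : (1 : Zp) n = (1%:Z %% q n)%Z by [].
by rewrite IH modzDm -PoszD addn1.
Qed.

Lemma residueB_eq0 x y n : (x - y) n = 0 <-> x n = y n.
Proof.
have -> : (x - y) n = ((x n - y n) %% q n)%Z.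
  by rewrite [LHS]/= modzDmr.
split=> [/dvdz_mod0P|->]; last by rewrite subrr mod0z.
by rewrite -eqz_mod_dvd !residue_mod => /eqP.
Qed.

(** Conversely to the obvious direction, when the [n]-th residue vanishes all
    later ones are multiples of [p ^ n], and shifting the sequence by [n] while
    dividing by [p ^ n] gives the residues of the quotient. *)
Lemma pdvd_residue n x : pdvd n x <-> x n = 0.
Proof.
split=> [[z ->]|x0].
  have -> : (P ^+ n * z) n = ((P ^+ n) n * z n %% q n)%Z by [].
  by rewrite -natrX residue_natr modzz mul0r mod0z.
have qn0 : q n != 0 by rewrite eqz_nat -lt0n expn_gt0 prime_gt0.
have dv m : (q n %| x (m + n)%N)%Z.
  by apply/dvdz_mod0P; rewrite residue_leq residue_mod.
have comp m : ((x (m.+1 + n)%N %/ q n)%Z = (x (m + n)%N %/ q n)%Z %[mod q m])%Z.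
  apply/eqP; rewrite eqz_mod_dvd -(dvdz_mul2r qn0) mulrBl.
  rewrite !divzK // -PoszM -expnD -eqz_mod_dvd addSn; apply/eqP.
  by rewrite -(residueE x (m + n)) residue_mod.
exists (padic_lim p_pr comp); apply: padic_eqP => m.
have -> : (P ^+ n * padic_lim p_pr comp) m =
  ((P ^+ n) m * padic_lim p_pr comp m %% q m)%Z by [].
rewrite -natrX residue_natr padic_limE modzMm mulrC divzK //.
by rewrite addnC -(residue_mod x m) -(residue_leq x m n) addnC.
Qed.

Lemma pdvd_congr n x y : pdvd n (x - y) <-> x n = y n.
Proof. by rewrite pdvd_residue residueB_eq0. Qed.

Lemma padic_separated x y : (forall n, pdvd n (x - y)) -> x = y.
Proof. by move=> h; apply: padic_eqP => n; apply/pdvd_congr. Qed.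

(** The limit is the diagonal sequence of residues [u n n]. *)
Lemma padic_complete (u : nat -> Zp) :
  (forall n, pdvd n (u n.+1 - u n)) -> exists l, forall n, pdvd n (l - u n).
Proof.
move=> hu.
have comp n : ((u n.+1 n.+1) = (u n n) %[mod q n])%Z.
  by rewrite -residueE -(iffLR (pdvd_congr _ _ _) (hu n)) residue_mod.
exists (padic_lim p_pr comp) => n.
by apply/pdvd_congr; rewrite padic_limE residue_mod.
Qed.

Lemma pdvd_nat n m : pdvd n m%:R -> (p ^ n %| m)%N.
Proof. by move/pdvd_residue; rewrite residue_natr => /dvdz_mod0P. Qed.

Lemma nat_dense x n : exists m : nat, pdvd n (x - m%:R).
Proof.
exists `|x n|%N; apply/pdvd_congr; rewrite residue_natr gez0_abs ?residue_mod //.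
by rewrite -residue_mod modz_ge0 // eqz_nat -lt0n expn_gt0 prime_gt0.
Qed.

Lemma p_neq0 : P != 0.
Proof.
apply/eqP => p0; have /pdvd_nat : pdvd 2 P by rewrite p0; apply: pdvd0.
by move/(dvdn_leq (prime_gt0 p_pr)); have := prime_gt1 p_pr; nia.
Qed.

Lemma pdvd_pM_inv k x : pdvd k.+1 (P * x) -> pdvd k x.
Proof.
by case=> z; rewrite exprS -mulrA => /(mulfI p_neq0) ->; exists z.
Qed.

Lemma pdiv_pow_tofrac k x : pdiv_pow k (tofrac x) <-> pdvd k x.
Proof. by split=> [[z /eqP]|[z ->]]; [rewrite tofrac_eq => /eqP|]; exists z. Qed.

(** Bezout on a natural number congruent to [a] modulo [p]. *)
Lemma pdvd_inv_mod_p (a : Zp) : ~ pdvd 1 a -> exists c, pdvd 1 (c * a - 1).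
Proof.
move=> a1; have [m am] := nat_dense a 1.
have cop : coprime m p.
  rewrite coprime_sym prime_coprime //; apply/negP => /dvdnP[j Ej]; apply: a1.
  rewrite -(subrK m%:R a); apply: pdvdD => //.
  by exists j%:R; rewrite Ej natrM expr1 mulrC.
have m_gt0 : (0 < m)%N.
  case: (m) cop => //; rewrite /coprime gcd0n => /eqP p1.
  by have := prime_gt1 p_pr; rewrite p1.
have [c d Ecd _] := egcdnP p m_gt0.
exists c%:R.
rewrite (_ : c%:R * a - 1 = c%:R * (a - m%:R) + ((c * m)%N%:R - 1)); last first.
  by rewrite natrM; ring.
apply: pdvdD; first exact: pdvdMl.
rewrite Ecd (eqP cop) natrD addrK natrM; exists d%:R.
by rewrite expr1 mulrC.
Qed.

End Divisibility.

(** * Zeros of functions that are linear to first order *)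

Section ContractionRoot.
Variables (p : nat) (p_pr : prime p).
Local Notation Zp := (padic_int p_pr).
Local Notation P := (p%:R : Zp).

(** The two hypotheses, the second one at [y = 0], make every value of [G]
    divisible by [p]; with [H = G / p], the map [x |-> x - H x] is then a contraction of [Z_p] by
    the factor [1 / p], and its fixed point is a zero of [G]. *)
Lemma contraction_root (G : Zp -> Zp) :
  pdvd 1 (G 0) ->
  (forall n x y, pdvd n (x - y) -> pdvd n.+2 (G x - G y - P * (x - y))) ->
  exists z, G z = 0.
Proof.
move=> G0 dG.
have dvdG x : exists h, G x = P * h.
  have [h Gx] : pdvd 1 (G x).
    have := dG 0%N x 0 (pdvd0n _) => /(@pdvdW _ _ 1) => /(_ isT) d.
    rewrite (_ : G x = G x - G 0 - P * (x - 0) + G 0 + P * (x - 0)); last by ring.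
    by do 2?apply: pdvdD => //; exact/pdvd_pM/pdvd0n.
  by exists h; rewrite Gx expr1.
have [H GH] := choice dvdG.
pose g x := x - H x.
have contr n x y : pdvd n (x - y) -> pdvd n.+1 (g x - g y).
  move=> /dG; rewrite !GH -!mulrBr => /pdvd_pM_inv /pdvdN.
  by congr pdvd; rewrite /g; ring.
have step n : pdvd n (iter n.+1 g 0 - iter n g 0).
  by elim: n => [|n IH]; [exact: pdvd0n | exact: contr].
have [l hl] := padic_complete step; exists l.
suff Hl : H l = 0 by rewrite GH Hl mulr0.
apply: padic_separated => n.
have /(pdvdW (leqnSn n)) dl := pdvdB (hl n.+1) (contr _ _ _ (hl n)).
by move: dl; congr pdvd; rewrite /g /=; ring.
Qed.

End ContractionRoot.

(** * The exponential with base 1 + p and its logarithm *)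

Section Exponential.

Lemma expr1D_order2 (R : comNzRingType) (x : R) n :
  exists r, (1 + x) ^+ n = 1 + n%:R * x + x ^+ 2 * r.
Proof.
elim: n => [|n [r IH]]; first by exists 0; rewrite expr0; ring.
exists (r + r * x + n%:R); rewrite exprSr IH -natr1; ring.
Qed.

Lemma expr1D_order3 (R : comNzRingType) (x : R) n :
  exists r, (1 + x) ^+ n = 1 + n%:R * x + 'C(n, 2)%:R * x ^+ 2 + x ^+ 3 * r.
Proof.
elim: n => [|n [r IH]]; first by exists 0; rewrite expr0 bin0n /=; ring.
exists (r + r * x + 'C(n, 2)%:R).
by rewrite exprSr IH binS bin1 natrD -natr1; ring.
Qed.

Variables (p : nat) (p_pr : prime p).
Hypothesis p_odd : odd p.
Local Notation Zp := (padic_int p_pr).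
Local Notation P := (p%:R : Zp).

(** Raising [1 + x] to the power [p] multiplies [x] by [p] to leading order.
    The quadratic term needs the factor [p] of ['C(p, 2)], available because
    [p] is odd: for [k = 0] its other factor [x ^ 2] brings only [p ^ 2]. *)
Lemma expr1p_pfactor k :
  pdvd k.+2 ((1 + P) ^+ (p ^ k)%N - (1 + P ^+ k.+1)).
Proof.
elim: k => [|k [z /(canRL (subrK _)) IH]].
  by rewrite expn0 !expr1 subrr; apply: pdvd0.
rewrite expnSr exprM IH.
set y := 1 + P * z.
have -> : P ^+ k.+2 * z + (1 + P ^+ k.+1) = 1 + P ^+ k.+1 * y.
  by rewrite /y !exprS; ring.
have [r ->] := expr1D_order3 (P ^+ k.+1 * y) p.
have /dvdnP[c ->] : (p %| 'C(p, 2))%N.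
  by apply: prime_dvd_bin => //; have := prime_gt1 p_pr; case: (p) p_odd => [|[|[]]].
exists (z + c%:R * P ^+ k * y ^+ 2 + P ^+ k * P ^+ k * y ^+ 3 * r).
by rewrite /y natrM !exprS; ring.
Qed.

Lemma expr1p_pfactorM k j :
  pdvd k.+2 ((1 + P) ^+ (p ^ k * j)%N - (1 + j%:R * P ^+ k.+1)).
Proof.
rewrite exprM; have [z /(canRL (subrK _)) ->] := expr1p_pfactor k.
have [r E] := expr1D_order2 (P ^+ k.+1 * (P * z + 1)) j.
have -> : P ^+ k.+2 * z + (1 + P ^+ k.+1) = 1 + P ^+ k.+1 * (P * z + 1).
  by rewrite !exprS; ring.
rewrite E; exists (j%:R * z + P ^+ k * (P * z + 1) ^+ 2 * r).
by rewrite !exprS; ring.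
Qed.

(** For [n = m + p ^ k j] the difference is
    [(1 + p) ^ m ((1 + p) ^ (p ^ k j) - 1)], where the first factor is [1] modulo
    [p] and the second one is [j p ^ (k + 1)] modulo [p ^ (k + 2)]. *)
Lemma expr1pB k n m : pdvd k (n%:R - m%:R : Zp) ->
  pdvd k.+2 ((1 + P) ^+ n - (1 + P) ^+ m - P * (n%:R - m%:R)).
Proof.
wlog le_mn : n m / (m <= n)%N.
  move=> wl; have [/wl//|/ltnW le_nm] := leqP m n => /pdvd_subC/(wl _ _ le_nm).
  by move/pdvdN; congr pdvd; ring.
rewrite -natrB // => /pdvd_nat/dvdnP[j]; rewrite mulnC => Ej.
have -> : (1 + P) ^+ n = (1 + P) ^+ m * (1 + P) ^+ (p ^ k * j)%N.
  by rewrite -Ej -exprD subnKC.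
rewrite Ej natrM natrX.
have [z /(canRL (subrK _)) ->] := expr1p_pfactorM k j.
have [r ->] := expr1D_order2 P m.
exists (((1 + m%:R * P + P ^+ 2 * r)) * z + (m%:R + P * r) * j%:R).
by rewrite !exprS; ring.
Qed.

(** This carries the well-definedness of [padic_pow]: the powers of [1 + p] along
    naturals tending to [s] form a Cauchy sequence by [expr1pB], and density of
    the naturals makes the limit unique. *)
Lemma padic_pow1p_approx (s : Zp) k n :
  pdvd k (s - n%:R) -> pdvd k.+1 (padic_pow (1 + P) s - (1 + P) ^+ n).
Proof.
have expB j a b : pdvd j (s - a%:R) -> pdvd j (s - b%:R) ->
    pdvd j.+1 ((1 + P) ^+ a - (1 + P) ^+ b).
  move=> sa sb.
  have dab : pdvd j (a%:R - b%:R : Zp).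
    by move: (pdvdB sb sa); congr pdvd; ring.
  have := pdvdD (pdvdW (leqnSn _) (expr1pB dab)) (pdvd_pM dab).
  by congr pdvd; ring.
have [a sa] := choice (nat_dense s).
have step j : pdvd j ((1 + P) ^+ a j.+1 - (1 + P) ^+ a j).
  apply: (pdvdW (leqnSn j)); apply: expB => //.
  exact: pdvdW (leqnSn j) (sa _).
have [v va] := padic_complete step.
have vP j b : pdvd j (s - b%:R) -> pdvd j.+1 (v - (1 + P) ^+ b).
  move=> sb; have := expB _ _ _ (pdvdW (leqnSn j) (sa j.+1)) sb.
  by move/(pdvdD (va j.+1)); congr pdvd; ring.
suff -> : padic_pow (1 + P) s = v by exact: vP.
rewrite /padic_pow; set A := (X in xget _ X).
have /(xgetPex 0) : exists v, A v.
  exists v => j; exists j => b /pdiv_pow_tofrac /vP dv.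
  exact/pdiv_pow_tofrac/(pdvdW (leqnSn j)).
set w := xget 0 A => wA; apply: padic_separated => j.
have [m wm] := wA j.
have mj : (m <= maxn m j)%N := leq_maxl m j.
have jm : (j <= maxn m j)%N := leq_maxr m j.
have /pdiv_pow_tofrac dw : pdiv_pow j (tofrac (w - (1 + P) ^+ a (maxn m j))).
  by apply: wm; apply/pdiv_pow_tofrac/(pdvdW mj)/sa.
have := pdvdB dw (pdvdW jm (va _)).
by congr pdvd; ring.
Qed.

(** Replacing [s] and [t] by naturals close to order [n + 1] changes both the
    powers and [p (s - t)] only by multiples of [p ^ (n + 2)]. *)
Lemma padic_pow1pB n (s t : Zp) : pdvd n (s - t) ->
  pdvd n.+2 (padic_pow (1 + P) s - padic_pow (1 + P) t - P * (s - t)).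
Proof.
move=> st.
have [a sa] := nat_dense s n.+1; have [b tb] := nat_dense t n.+1.
have dab : pdvd n (a%:R - b%:R : Zp).
  have d := pdvdW (leqnSn n) (pdvdB tb sa).
  by move: (pdvdD st d); congr pdvd; ring.
have := pdvdB (padic_pow1p_approx sa) (padic_pow1p_approx tb).
move/(pdvdD (expr1pB dab))/pdvdD/(_ (pdvd_pM (pdvdB tb sa))).
by congr pdvd; ring.
Qed.

Lemma padic_pow1p0 : padic_pow (1 + P) 0 = 1.
Proof.
apply: padic_separated => k; apply: (pdvdW (leqnSn k)).
by have := @padic_pow1p_approx 0 k 0; rewrite subrr expr0; apply; apply: pdvd0.
Qed.

(** Surjectivity of the exponential onto [1 + p Z_p], as a zero of
    [s |-> (1 + p) ^ s - u]. *)
Lemma padic_log1pK (u : Zp) :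
  pdvd 1 (u - 1) -> padic_pow (1 + P) (padic_log1p u) = u.
Proof.
move=> u1.
suff /(xgetPex 0) : exists s, padic_pow (1 + P) s = u by [].
have [||s /subr0_eq] := @contraction_root _ p_pr (fun s => padic_pow (1 + P) s - u).
- by rewrite padic_pow1p0; apply: pdvd_subC.
- by move=> n x y /padic_pow1pB; congr pdvd; ring.
by exists s.
Qed.

(** Modulo [p ^ 2] the equation [(1 + p) ^ s = u] reads [1 + p s = u]. *)
Lemma pdvd_log1p (u : Zp) : pdvd 2 (u - 1) -> pdvd 1 (padic_log1p u).
Proof.
move=> u1; have u1' := pdvdW (leqnSn 1) u1.
have := @padic_pow1pB 0 (padic_log1p u) 0 (pdvd0n _).
rewrite padic_log1pK // padic_pow1p0 subr0 => /(pdvdB u1) d.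
by apply: pdvd_pM_inv; move: d; congr pdvd; ring.
Qed.

End Exponential.

(** * Power series on p Z_p *)

Section PowerSeries.
Variables (p : nat) (p_pr : prime p).
Local Notation Zp := (padic_int p_pr).
Local Notation P := (p%:R : Zp).
Variable f : nat -> Zp.

Lemma series_eval_approx (x : Zp) n :
  pdvd 1 x -> pdvd n (series_eval f x - \sum_(k < n) f k * x ^+ k).
Proof.
move=> x1; pose S n := \sum_(k < n) f k * x ^+ k.
have step j : pdvd j (S j.+1 - S j).
  by rewrite /S big_ord_recr /= addrAC subrr add0r; apply/pdvdMl/pdvdX.
have [l hl] := padic_complete step.
suff -> : series_eval f x = l by exact: hl.
have cvgl : padic_cvg S l.
  move=> k; exists k => m km; apply/pdiv_pow_tofrac/pdvd_subC.
  exact: pdvdW km (hl m).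
have : padic_cvg S (series_eval f x) by apply: (xgetPex 0); exists l.
move=> cvgw; apply: padic_separated => k.
have [[N hN] [M hM]] := (cvgw k, cvgl k).
have /pdiv_pow_tofrac d1 := hN _ (leq_maxl N M).
have /pdiv_pow_tofrac d2 := hM _ (leq_maxr N M).
by move: (pdvdB d2 d1); congr pdvd; ring.
Qed.

Lemma series_eval0 : series_eval f 0 = f 0%N.
Proof.
apply: padic_separated => k; apply: (pdvdW (leqnSn k)).
have := series_eval_approx k.+1 (pdvd0 p_pr 1).
rewrite big_ord_recl big1 ?addr0 ?expr0 ?mulr1 // => i _.
by rewrite expr0n mulr0.
Qed.

(** Each term of degree [m >= 2] contributes [p ^ m (x ^ m - y ^ m)], a multiple
    of [p ^ 2 (x - y)]; truncating the series at degree [n + 2] loses only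
    multiples of [p ^ (n + 2)]. *)
Lemma series_evalB n (x y : Zp) : pdvd n (x - y) ->
  pdvd n.+2 (series_eval f (P * x) - series_eval f (P * y)
             - P * f 1%N * (x - y)).
Proof.
move=> xy; have P1 z : pdvd 1 (P * z) by exact/pdvd_pM/pdvd0n.
have := pdvdB (series_eval_approx n.+2 (P1 x)) (series_eval_approx n.+2 (P1 y)).
rewrite !big_ord_recl /= /bump /=.
set A := \sum_(i < n) _; set B := \sum_(i < n) _.
have AB : pdvd n.+2 (A - B).
  rewrite -sumrB; apply: pdvd_sum => i; rewrite -mulrBr; apply: pdvdMl.
  rewrite !exprMn -mulrBr subrXX; have [z ->] := xy.
  set w := \sum_(_ < _) _.
  by exists (P ^+ i * z * w); rewrite !add1n !exprS; ring.
by move/pdvdD/(_ AB); congr pdvd; rewrite !expr0 !expr1; ring.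
Qed.

(** The zero found is [p z] with [c f(p z) = 0].  Comparing with [t = 0] gives
    [c f(0) + p z = 0] modulo [p ^ 2], which is why divisibility of the constant
    term by [p ^ 2] passes to the zero. *)
Lemma series_eval_root : ~ pdvd 1 (f 1%N) -> pdvd 2 (f 0%N) ->
  exists2 x, pdvd 2 x & series_eval f x = 0.
Proof.
move=> f1 f0; have [c c1] := pdvd_inv_mod_p f1.
pose G x := c * series_eval f (P * x).
have dG n x y : pdvd n (x - y) -> pdvd n.+2 (G x - G y - P * (x - y)).
  move=> xy; have := pdvdM c1 (pdvd_pM xy); rewrite add1n.
  by move/(pdvdD (pdvdMl c (series_evalB xy))); congr pdvd; rewrite /G; ring.
have G0 : pdvd 2 (G 0) by rewrite /G mulr0 series_eval0; apply: pdvdMl.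
have [z Gz] := contraction_root (pdvdW (leqnSn 1) G0) dG.
exists (P * z).
  apply: pdvd_pM; apply: pdvd_pM_inv.
  have := pdvdN (pdvdD (dG 0%N z 0 (pdvd0n _)) G0).
  by rewrite Gz; congr pdvd; ring.
(* [c] is nonzero, being invertible modulo [p] *)
move/eqP: Gz; rewrite mulf_eq0 => /orP[/eqP c0|/eqP //].
case: f1; rewrite c0 mul0r sub0r in c1.
by move: (pdvdMl (f 1%N) (pdvdN c1)); rewrite opprK mulr1.
Qed.

End PowerSeries.

Theorem theorem8p7 (p : nat) (p_pr : prime p) (i : nat)
    (L : padic_int p_pr -> {fraction padic_int p_pr})
    (f : nat -> padic_int p_pr) :
  semi_regular p ->
  odd i -> (3 <= i <= p - 2)%N ->
  is_padic_L (1 - i%:Z) L ->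
  (forall s, (series_eval f (padic_pow (1 + p%:R) s - 1))%:F = L s) ->
  is_iwasawa_lambda f 1 ->
  ~ (exists s0 a b : padic_int p_pr,
       [/\ L s0 = 0,
           s0 = padic_log1p (1 + a * p%:R ^+ 2) &
           s0 = b * p%:R]) ->
  ~ pdiv_pow 2 (L 0).
Proof.
move=> [_ p_odd _] _ _ _ fL [f1 _] noroot L0; apply: noroot.
have f0 : pdvd 2 (f 0%N).
  apply/pdiv_pow_tofrac; move: L0.
  by rewrite -fL padic_pow1p0 // subrr series_eval0.
have [x [a Ex] fx] :=
  series_eval_root (fun d => f1 (iffRL (pdiv_pow_tofrac _ _) d)) f0.
have u2 : pdvd 2 (1 + a * p%:R ^+ 2 - 1 : padic_int p_pr).
  by exists a; ring.
have [b Eb] := pdvd_log1p p_odd u2.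
exists (padic_log1p (1 + a * p%:R ^+ 2)), a, b; split=> //; last first.
  by rewrite Eb expr1 mulrC.
rewrite -fL padic_log1pK //; last exact: pdvdW u2.
by rewrite addrAC subrr add0r mulrC -Ex fx tofrac0.
Qed.
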